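(* Let $Y=[0,1]$ and, for $y\in Y$, $$G_0(y)=\frac{2+y}{5},\quad G_1(y)=\frac{3-y}{5},\quad H_0(y)=\frac{1+2y}{2+y},\quad H_1(y)=\frac{y}{3-y}.$$ Let $\{\mu_y\}_{y\in Y}$ be the unique family of Borel probability measures on $[0,1]$ satisfying $\mu_y=\sum_{i=0}^1G_i(y)\,\mu_{H_i(y)}\circ S_i^{-1}$ for all $y\in Y$, where $S_i(z)=(z+i)/2$. Then, for every $y\in Y$, $\mu_y$ is singular with respect to every $(p_0,p_1)$-self-similar measure.
   Context: For $p_0,p_1\ge 0$ with $p_0+p_1=1$, the $(p_0,p_1)$-self-similar measure is the unique Borel probability measure $\mu$ on $[0,1]$ with $\mu=p_0\,\mu\circ S_0^{-1}+p_1\,\mu\circ S_1^{-1}$, where $S_i(z)=(z+i)/2$ for $z\in[0,1]$. *)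

(* Defs.v *)
From HB Require Import structures.
From mathcomp Require Import all_boot all_order all_algebra.
From mathcomp Require Import all_classical all_reals all_analysis.

Set Implicit Arguments.
Unset Strict Implicit.
Unset Printing Implicit Defensive.

Import Order.TTheory GRing.Theory Num.Theory.

Local Open Scope classical_set_scope.
Local Open Scope ring_scope.

(* A Borel probability measure on [0,1] is encoded as a Borel probability
   measure on R giving mass 1 to [0,1].  Accordingly Smap i is extended to R by
   the same formula; since the measures pushed forward live on [0,1], the
   values of Smap i outside [0,1] do not matter. *)
Definition on_unit_interval (R : realType)
    (m : probability (measurableTypeR R) R) : Prop :=
  m [set` `[0%R, 1%R]] = 1%E.

Definition Smap (R : realType) (i : 'I_2) (z : R) : R := (z + i%:R) / 2.

Definition G (R : realType) (i : 'I_2) (y : R) : R :=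
  if i == ord0 then (2 + y) / 5 else (3 - y) / 5.

Definition H (R : realType) (i : 'I_2) (y : R) : R :=
  if i == ord0 then (1 + 2 * y) / (2 + y) else y / (3 - y).

(* Only the members mu y with y in [0,1] are constrained; G and H have nonzero
   denominators there and H i maps [0,1] into itself. *)
Definition is_GH_family (R : realType)
    (mu : R -> probability (measurableTypeR R) R) : Prop :=
  forall y : R, 0 <= y <= 1 ->
    on_unit_interval (mu y) /\
    forall A : set (measurableTypeR R), measurable A ->
      mu y A = (\sum_(i < 2) (G i y)%:E * pushforward (mu (H i y)) (Smap i) A)%E.

Definition self_similar (R : realType) (p0 p1 : R)
    (nu : probability (measurableTypeR R) R) : Prop :=
  on_unit_interval nu /\
  forall A : set (measurableTypeR R), measurable A ->
    nu A = (p0%:E * pushforward nu (Smap ord0) A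
            + p1%:E * pushforward nu (Smap ord_max) A)%E.

Definition mutually_singular (d : measure_display) (T : measurableType d)
    (R : realType) (m1 m2 : {measure set T -> \bar R}) : Prop :=
  exists2 A : set T, measurable A & m1 A = 0%E /\ m2 (~` A) = 0%E.

(* Main.v *)
Require Import Defs.
From HB Require Import structures.
From mathcomp Require Import all_boot all_order all_algebra.
From mathcomp Require Import all_classical all_reals all_analysis.
From mathcomp Require Import ring lra measurable_realfun.

Set Implicit Arguments.
Unset Strict Implicit.
Unset Printing Implicit Defensive.

Import Order.TTheory GRing.Theory Num.Theory.

Local Open Scope classical_set_scope.
Local Open Scope ring_scope.

(* Hellinger affinity.  Distinguishing [mu y] from [nu] after reading one binary
   digit costs a factor: the affinity operator
     [L k y = sum_i sqrt (G_i y * p_i) * k (H_i y)]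
   satisfies [L 1 <= 1], with equality only where [G_0 y = p_0].  As
   [G_0 (H_0 y) - G_0 (H_1 y) >= 1/10], equality cannot persist for two digits, and
   [L (L 1) <= c < 1] uniformly in [y].  Hence sets with
   [mu y A + nu (~` A) <= c ^+ n] exist for all [n], and Borel-Cantelli applies. *)

(** * Bounds on the weights and on the maps of the parameter *)

Section Weights.
Context {R : realType}.
Implicit Types (y a b p : R) (i : 'I_2).

Lemma G_bounds i y : 0 <= y <= 1 -> 2 / 5 <= G i y <= 3 / 5.
Proof. by move=> /andP[y0 y1]; rewrite /G; case: ifP => _; lra. Qed.

Lemma G_ge0 i y : 0 <= y <= 1 -> 0 <= G i y.
Proof. by move=> /(G_bounds i)/andP[+ _]; apply: le_trans; lra. Qed.

Lemma G_sum y : G ord0 y + G ord_max y = 1.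
Proof. by rewrite /G /=; lra. Qed.

Lemma H_unit i y : 0 <= y <= 1 -> 0 <= H i y <= 1.
Proof.
move=> /andP[y0 y1]; rewrite /H; case: ifP => _.
  by rewrite divr_ge0 ?ler_pdivrMr; lra.
by rewrite divr_ge0 ?ler_pdivrMr; lra.
Qed.

(** With [u = y * (1 - y)], the difference equals [3 * (1 + u) / (5 * (6 + u))]. It increases with
    [u >= 0], so its minimum 1/10 is attained at the endpoints. *)
Lemma G0_H_gap y : 0 <= y <= 1 ->
  1 / 10 <= G ord0 (H ord0 y) - G ord0 (H ord_max y).
Proof.
move=> /andP[y0 y1]; rewrite /G /H /=.
have d0 : 0 < (2 + y) * (3 - y) by apply: mulr_gt0; lra.
have -> : (2 + (1 + 2 * y) / (2 + y)) / 5 - (2 + y / (3 - y)) / 5 =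
    (3 + 3 * y - 3 * y ^+ 2) / (5 * ((2 + y) * (3 - y))).
  by field; apply/andP; split; lra.
rewrite ler_pdivlMr; last lra.
by have := mulr_ge0 y0 (_ : 0 <= 1 - y); nra.
Qed.

(* From [(x - y)^2 = (x^2 - y^2)^2 / (x + y)^2] with [x + y <= 2]. *)
Lemma sqrtM_le_defect a b : 0 <= a <= 1 -> 0 <= b <= 1 ->
  Num.sqrt (a * b) <= (a + b) / 2 - (a - b) ^+ 2 / 8.
Proof.
move=> /andP[a0 a1] /andP[b0 b1]; rewrite sqrtrM//.
have := sqr_sqrtr a0; have := sqr_sqrtr b0.
have := sqrtr_ge0 a; have := sqrtr_ge0 b.
have : Num.sqrt a <= 1 by rewrite -sqrtr1 ler_sqrt.
have : Num.sqrt b <= 1 by rewrite -sqrtr1 ler_sqrt.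
set x := Num.sqrt a; set z := Num.sqrt b => z1 x1 z0 x0 <- <-.
rewrite -subr_ge0.
have -> : (x ^+ 2 + z ^+ 2) / 2 - (x ^+ 2 - z ^+ 2) ^+ 2 / 8 - x * z =
  (x - z) ^+ 2 * ((2 - (x + z)) * (2 + (x + z))) / 8 by field.
by rewrite divr_ge0// mulr_ge0 ?sqr_ge0// mulr_ge0; lra.
Qed.

End Weights.

(** * Uniform contraction of the affinity operator over two digits *)

Section Affinity.
Context {R : realType} (p0 p1 : R).
Hypotheses (p0_ge0 : 0 <= p0) (p1_ge0 : 0 <= p1) (p01 : p0 + p1 = 1).

Definition affinity (k : R -> R) (y : R) : R :=
  Num.sqrt (G ord0 y * p0) * k (H ord0 y) +
  Num.sqrt (G ord_max y * p1) * k (H ord_max y).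

(** As [G_1 - p1 = - (G_0 - p0)], the two digits have the same defect [(G_0 - p0)^2 / 8], while the
    arithmetic means add up to 1. *)
Lemma affinity1_le (y : R) : 0 <= y <= 1 ->
  affinity (fun=> 1) y <= 1 - (G ord0 y - p0) ^+ 2 / 4.
Proof.
move=> y01; rewrite /affinity !mulr1.
have Gle i : 0 <= G i y <= 1 by have /andP[? ?] := G_bounds i y01; lra.
have p0le : 0 <= p0 <= 1 by rewrite p0_ge0 -p01 lerDl.
have p1le : 0 <= p1 <= 1 by rewrite p1_ge0 -p01 lerDr.
have := sqrtM_le_defect (Gle ord0) p0le.
have := sqrtM_le_defect (Gle ord_max) p1le.
have -> : G ord_max y = 1 - G ord0 y by have := G_sum y; lra.
have -> : p1 = 1 - p0 by rewrite -p01 addrC addKr.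
by nra.
Qed.

(** The loss 1/2400 is 1/3 * 1/4 * 1/200: a lower bound for the square roots, the constant of
    [affinity1_le], and a lower bound for the two squared deviations at the second digit. *)
Lemma affinity2_le (y : R) : 0 <= y <= 1 ->
  affinity (affinity (fun=> 1)) y <= 2399 / 2400.
Proof.
move=> y01; have f1 := affinity1_le y01.
have f2 i := affinity1_le (H_unit i y01).
have gap := G0_H_gap y01.
move: f1; rewrite {1 2}/affinity !mulr1 => f1.
move: (f2 ord0) (f2 ord_max); move: (affinity _ _) (affinity _ _) => k1 k0.
move: gap; move: (G ord0 (H _ _)) (G ord0 (H _ _)) => g1 g0 gap k0_le k1_le.
have q0 := sqr_ge0 (g0 - p0); have q1 := sqr_ge0 (g1 - p0).
(* If [p0] is at least 1/10 away from [G_0 y], the first digit alone loses 1/400. *)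
have [pfar|] := boolP (1 / 100 <= (G ord0 y - p0) ^+ 2).
  have s0 := sqrtr_ge0 (G ord0 y * p0); have s1 := sqrtr_ge0 (G ord_max y * p1).
  have k0_le1 : k0 <= 1 by lra.
  have k1_le1 : k1 <= 1 by lra.
  by have := ler_wpM2l s0 k0_le1; have := ler_wpM2l s1 k1_le1; lra.
rewrite -ltNge => pnear.
(* Now [p0] is within 1/10 of [G_0 y], which lies in [2/5, 3/5]. Both square roots then exceed 1/3,
   since 2/5 * 3/10 > 1/9. *)
have [p0_ge p1_ge] : 3 / 10 <= p0 /\ 3 / 10 <= p1.
  by have /andP[? ?] := G_bounds ord0 y01; move: p01; split; nra.
have s_ge i (p : R) : 3 / 10 <= p -> 1 / 3 <= Num.sqrt (G i y * p).
  move=> p_ge; have /andP[? ?] := G_bounds i y01.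
  have -> : 1 / 3 = Num.sqrt ((1 / 3) ^+ 2) :> R.
    by rewrite sqrtr_sqr ger0_norm//; lra.
  by rewrite ler_sqrt; nra.
have := s_ge ord0 _ p0_ge; have := s_ge ord_max _ p1_ge; move: f1.
set s0 := Num.sqrt _; set s1 := Num.sqrt _ => f1 s1_ge s0_ge.
(* Parallelogram law: the sum is at least [(g0 - g1)^2 / 2], and [g0 - g1 >= 1/10]. *)
have : 1 / 200 <= (g0 - p0) ^+ 2 + (g1 - p0) ^+ 2.
  by have := sqr_ge0 (g0 - p0 + (g1 - p0)); nra.
have : s0 * k0 <= s0 - 1 / 12 * (g0 - p0) ^+ 2 by nra.
have : s1 * k1 <= s1 - 1 / 12 * (g1 - p0) ^+ 2 by nra.
have := sqr_ge0 (G ord0 y - p0); lra.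
Qed.

End Affinity.

Lemma near_expr_le (R : realType) (c e : R) : 0 <= c < 1 -> 0 < e ->
  \forall n \near \oo, c ^+ n <= e.
Proof.
move=> /andP[c0 c1] e0; have c_lt1 : `|c| < 1 by rewrite ger0_norm.
have /cvgrPdist_le/(_ e e0) := cvg_geometric 1 c_lt1.
apply: filterS => n; rewrite sub0r normrN /= mul1r.
exact: le_trans (ler_norm _).
Qed.

(** * Singularity from almost separating sets *)

Section Probability.
Context {d : measure_display} {T : measurableType d} {R : realType}.
Implicit Types (m : probability T R) (A B : set T).

Lemma fineK_probability m A : measurable A -> (fine (m A))%:E = m A.
Proof. by move=> mA; rewrite fineK ?fin_num_measure. Qed.

Lemma fine_probability_ge0 m A : 0 <= fine (m A).
Proof. exact: fine_ge0. Qed.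

Lemma fine_probability_le1 m A : measurable A -> fine (m A) <= 1.
Proof. by move=> mA; rewrite -lee_fin fineK_probability ?probability_le1. Qed.

(** The null set [N] absorbs the points at or beyond the ends of [0,1] that the gluing of two sets
    misplaces. *)
Lemma le_fine_probability m A B N : measurable A -> measurable B ->
  measurable N -> m N = 0%E -> A `<=` B `|` N -> fine (m A) <= fine (m B).
Proof.
move=> mA mB mN N0 AB; rewrite -lee_fin !fineK_probability//.
apply: (@le_trans _ _ (m (B `|` N))).
  by rewrite le_measure ?inE//; exact: measurableU.
by have := measureU2 m mB mN; rewrite [X in (_ <= _ + X)%E]N0 adde0.
Qed.

(** Choose [A n] for the summable errors [2^-(n+1)]. Their limsup is [m1]-null by Borel-Cantelli,
    and its complement is a countable union of [m2]-null sets. *)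
Lemma mutually_singular_of_small m1 m2 :
  (forall e : R, 0 < e -> exists2 A, measurable A &
    fine (m1 A) <= e /\ fine (m2 (~` A)) <= e) ->
  mutually_singular m1 m2.
Proof.
move=> small.
have e_gt0 n : 0 < 1 / (2 ^ (n + 1))%:R :> R.
  by rewrite divr_gt0// ltr0n expn_gt0.
have /choice[A A_small] n : exists A, measurable A /\
    fine (m1 A) <= 1 / (2 ^ (n + 1))%:R /\
    fine (m2 (~` A)) <= 1 / (2 ^ (n + 1))%:R.
  by have [A ? ?] := small _ (e_gt0 n); exists A.
have mA n : measurable (A n) by case: (A_small n).
have mL : measurable (lim_sup_set A).
  by apply: bigcap_measurable => // n _; exact: bigcup_measurable.
exists (lim_sup_set A) => //; split.
  apply: lim_sup_set_cvg0 => //.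
  apply: (@le_lt_trans _ _ (\sum_(n <oo) (1 / (2 ^ (n + 1))%:R)%:E)%E).
    apply: lee_nneseries => [n *|n _]; first by [].
    by have [_ [+ _]] := A_small n; rewrite -lee_fin fineK_probability.
  have /cvg_lim -> // := @cvg_geometric_eseries_half R 1 0.
  by rewrite ltry.
have -> : ~` lim_sup_set A = \bigcup_n \bigcap_(j >= n) ~` A j.
  by rewrite /lim_sup_set setC_bigcap; apply: eq_bigcupr => n _; rewrite setC_bigcup.
have mI n : measurable (\bigcap_(j >= n) ~` A j).
  by apply: bigcap_measurable => [|j _]; [exists n => /=|exact: measurableC].
apply/negligibleP; first exact: bigcup_measurable.
apply: negligible_bigcup => n; apply/negligibleP => //.
rewrite -[LHS]fineK_probability//; congr (_%:E).
apply/eqP; rewrite eq_le fine_probability_ge0 andbT.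
apply/ler_addgt0Pl => e e0; rewrite addr0.
have [k nk ke] : exists2 k, (n <= k)%N & 1 / (2 ^ (k + 1))%:R <= e.
  have [|N _ Nle] := @near_expr_le R (1 / 2) e _ e0; first lra.
  exists (maxn n N); first exact: leq_maxl.
  apply: le_trans (Nle (maxn n N + 1)%N _); last first.
    by rewrite /= addn1 leqW// leq_maxr.
  by rewrite expr_div_n expr1n natrX.
apply: le_trans ke; have [_ [_ ]] := A_small k; apply: le_trans.
apply: (@le_fine_probability _ _ _ set0) => //; first exact: measurableC.
by rewrite setU0; exact: bigcap_inf.
Qed.

End Probability.

(** * The two measures at the endpoints of [0,1] *)

Section Family.
Context {R : realType}.
Local Notation T := (measurableTypeR R).
Implicit Types (A E : set T) (m : probability T R) (i : 'I_2) (y : R).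

Lemma measurable_affine_preimage (a b : R) A : measurable A ->
  measurable ((fun x => a * x + b) @^-1` A).
Proof.
move=> mA; rewrite -[X in measurable X]setTI.
suff : measurable_fun setT (fun x : T => a * x + b : T) by exact.
by apply: measurable_funD => //; exact: mulrl_measurable.
Qed.

Lemma measurable_Smap_preimage i A : measurable A -> measurable (Smap i @^-1` A).
Proof.
have -> : Smap i = (fun x => 2^-1 * x + i%:R / 2) :> (R -> R).
  by apply/funext => x; rewrite /Smap mulrDl mulrC.
exact: measurable_affine_preimage.
Qed.

Lemma on_unit_interval_null m E : on_unit_interval m -> measurable E ->
  E `&` [set` `[0%R, 1%R]] = set0 -> m E = 0%E.
Proof.
move=> m1 mE E01; apply/eqP; rewrite eq_le measure_ge0 andbT.
have mI : measurable ([set` `[0%R, 1%R]] : set T) by exact: measurable_itv.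
have <- : (m (~` [set` `[0%R, 1%R]]) = 0)%E.
  by rewrite probability_setC// m1 subee.
rewrite le_measure ?inE//; first exact: measurableC.
by move=> x Ex x01; rewrite -[False]/(set0 x) -E01.
Qed.

Variables (mu : R -> probability T R).
Hypothesis mu_family : is_GH_family mu.

Lemma family_fine y A : 0 <= y <= 1 -> measurable A ->
  fine (mu y A) =
    G ord0 y * fine (mu (H ord0 y) (Smap ord0 @^-1` A)) +
    G ord_max y * fine (mu (H ord_max y) (Smap ord_max @^-1` A)).
Proof.
move=> y01 mA; have [_ /(_ _ mA) ->] := mu_family y01.
rewrite big_ord_recl big_ord1.
have -> : lift ord0 ord0 = ord_max :> 'I_2 by exact: val_inj.
rewrite /pushforward.
rewrite -(fineK_probability (mu (H ord0 y)) (measurable_Smap_preimage ord0 mA)).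
by rewrite -(fineK_probability (mu (H ord_max y)) (measurable_Smap_preimage _ mA)).
Qed.

(* The half-lines beyond an endpoint are fixed by one inverse branch and pushed
   off [0,1] by the other, so their mass shrinks by a factor G <= 3/5. *)
Lemma family_null i E y : 0 <= y <= 1 -> measurable E ->
  Smap i @^-1` E = E ->
  (forall j, j != i -> (Smap j @^-1` E) `&` [set` `[0%R, 1%R]] = set0) ->
  mu y E = 0%E.
Proof.
move=> y01 mE Ei Ej.
(* The bound is uniform in [z] because each induction step replaces [z] by [H i z]. *)
suff bnd n : forall z, 0 <= z <= 1 -> fine (mu z E) <= (3 / 5) ^+ n.
  rewrite -fineK_probability//; congr (_%:E); apply/eqP.
  rewrite eq_le fine_probability_ge0 andbT.
  apply/ler_addgt0Pl => e e0; rewrite addr0.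
  have [|N _ Nle] := @near_expr_le R (3 / 5) e _ e0; first lra.
  by apply: le_trans (Nle N _) => /=; first exact: bnd.
elim: n => [|n IHn] z z01; first by rewrite fine_probability_le1.
have j_null j : j != i -> fine (mu (H j z) (Smap j @^-1` E)) = 0.
  move=> ji; have [m1 _] := mu_family (H_unit j z01).
  rewrite (on_unit_interval_null m1) ?Ej//.
  exact: measurable_Smap_preimage.
have -> : fine (mu z E) = G i z * fine (mu (H i z) E).
  rewrite (family_fine z01 mE).
  have [i_eq|i_eq] : i = ord0 \/ i = ord_max.
    by case: i {Ei Ej j_null} => [[|[|//]] ?]; [left|right]; exact: val_inj.
  - by subst i; rewrite Ei (j_null ord_max)// mulr0 addr0.
  - by subst i; rewrite Ei (j_null ord0)// mulr0 add0r.
rewrite exprS ler_pM ?G_ge0 ?fine_probability_ge0 ?IHn ?H_unit//.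
by have /andP[] := G_bounds i z01.
Qed.

(** Including the endpoint matters: [mu y] has no atom at 1, nor at 0 by the companion lemma, so the
    two halves of [0,1] may overlap at 1/2. *)
Lemma family_right_null y : 0 <= y <= 1 -> mu y `[1%R, +oo[%classic = 0%E.
Proof.
move=> y01; apply: (@family_null ord_max) => //.
  by apply/seteqP; split => x /=; rewrite /Smap /= !in_itv /= !andbT; lra.
move=> j; case: j => [[|[|//]] ?] //= _.
by apply/seteqP; split => x //=; rewrite /Smap /= !in_itv /= => -[]; lra.
Qed.

Lemma family_left_null y : 0 <= y <= 1 -> mu y `]-oo, 0%R]%classic = 0%E.
Proof.
move=> y01; apply: (@family_null ord0) => //.
  by apply/seteqP; split => x /=; rewrite /Smap /= !in_itv /=; lra.
move=> j; case: j => [[|[|//]] ?] //= _.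
by apply/seteqP; split => x //=; rewrite /Smap /= !in_itv /= => -[]; lra.
Qed.

(** * Separating sets built digit by digit *)

Variables (p0 p1 : R) (nu : probability T R).
Hypotheses (p0_ge0 : 0 <= p0) (p1_ge0 : 0 <= p1) (p01 : p0 + p1 = 1).
Hypothesis nu_ss : self_similar p0 p1 nu.

Lemma self_similar_fine A : measurable A ->
  fine (nu A) = p0 * fine (nu (Smap ord0 @^-1` A)) +
                p1 * fine (nu (Smap ord_max @^-1` A)).
Proof.
move=> mA; have [_ /(_ _ mA) ->] := nu_ss.
rewrite /pushforward.
rewrite -(fineK_probability nu (measurable_Smap_preimage ord0 mA)).
by rewrite -(fineK_probability nu (measurable_Smap_preimage ord_max mA)).
Qed.

(* Allowing arbitrary weights [s], [t] makes the bound stable under gluing: the two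
   branches are used with the weights [s * G_i y] and [t * p_i]. *)
Definition separated_by (k : R -> R) : Prop :=
  forall y, 0 <= y <= 1 -> forall s t : R, 0 <= s -> 0 <= t ->
  exists2 A, measurable A &
    s * fine (mu y A) + t * fine (nu (~` A)) <= Num.sqrt (s * t) * k y.

(** With no digit read, the whole line or the empty set achieves [min s t], which is at most
    [sqrt (s * t)]. *)
Lemma separated_by1 : separated_by (fun=> 1).
Proof.
move=> y y01 s t s0 t0; rewrite mulr1.
have [st|/ltW ts] := leP s t.
  exists setT => //; rewrite setCT measure0 probability_setT /= mulr0 addr0 mulr1.
  by rewrite -[leLHS](ger0_norm s0) -sqrtr_sqr ler_sqrt ?mulr_ge0// ler_wpM2l.
exists set0 => //; rewrite setC0 measure0 probability_setT /= mulr0 add0r mulr1.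
by rewrite -[leLHS](ger0_norm t0) -sqrtr_sqr ler_sqrt ?mulr_ge0// ler_wpM2r.
Qed.

Lemma separated_by_le k k' : (forall y, 0 <= y <= 1 -> k y <= k' y) ->
  separated_by k -> separated_by k'.
Proof.
move=> kk' sep y y01 s t s0 t0; have [A mA Ale] := sep y y01 s t s0 t0.
by exists A => //; rewrite (le_trans Ale)// ler_wpM2l ?sqrtr_ge0 ?kk'.
Qed.

(** Sets that separate [mu (H i y)] from [nu] are copied by [Smap i] into the two halves. The
    weighted error of the union is at most the sum of the errors of the two branches. *)
Lemma separated_by_affinity k :
  separated_by k -> separated_by (affinity p0 p1 k).
Proof.
move=> sep y y01 s t s0 t0.
have [B0 mB0 le0] := sep _ (H_unit ord0 y01) (s * G ord0 y) (t * p0)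
  (mulr_ge0 s0 (G_ge0 ord0 y01)) (mulr_ge0 t0 p0_ge0).
have [B1 mB1 le1] := sep _ (H_unit ord_max y01) (s * G ord_max y) (t * p1)
  (mulr_ge0 s0 (G_ge0 ord_max y01)) (mulr_ge0 t0 p1_ge0).
(* Both halves are closed at 1/2. The overlap costs nothing for [mu], which has no atoms at 0 and 1.
   For [nu], possibly a Dirac mass at 0 or 1, only the open half-lines outside [0,1] then have to be
   null. *)
pose A : set T := (`]-oo, 2^-1]%classic `&` (fun x => 2 * x + 0) @^-1` B0) `|`
                  (`[2^-1, +oo[%classic `&` (fun x => 2 * x + -1) @^-1` B1).
have mA : measurable A.
  by apply: measurableU; apply: measurableI => //; exact: measurable_affine_preimage.
exists A => //; rewrite (family_fine y01 mA) (self_similar_fine (measurableC mA)).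
have S0K x : 2 * Smap ord0 x + 0 = x by rewrite /Smap /=; field.
have S1K x : 2 * Smap ord_max x + -1 = x by rewrite /Smap /=; field.
have mu0 : fine (mu (H ord0 y) (Smap ord0 @^-1` A)) <= fine (mu (H ord0 y) B0).
  apply: le_fine_probability (family_right_null (H_unit ord0 y01)) _ => //.
    exact: measurable_Smap_preimage.
  move=> x [[_ /=]|[/= + _]]; first by rewrite S0K; left.
  by rewrite /Smap !in_itv /= !andbT => ?; right; rewrite /= ?in_itv /= ?andbT; lra.
have mu1 : fine (mu (H ord_max y) (Smap ord_max @^-1` A)) <=
    fine (mu (H ord_max y) B1).
  apply: le_fine_probability (family_left_null (H_unit ord_max y01)) _ => //.
    exact: measurable_Smap_preimage.
  move=> x [[/= + _]|[_ /=]]; last by rewrite S1K; left.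
  by rewrite /Smap !in_itv /= => ?; right; rewrite /= ?in_itv /= ?andbT; lra.
have [nu01 _] := nu_ss.
have nu0 : fine (nu (Smap ord0 @^-1` (~` A))) <= fine (nu (~` B0)).
  have nuN : nu `]1%R, +oo[%classic = 0%E.
    apply: on_unit_interval_null => //.
    by apply/seteqP; split => x //=; rewrite !in_itv /= => -[]; lra.
  apply: le_fine_probability nuN _ => //.
  - by apply: measurable_Smap_preimage; exact: measurableC.
  - exact: measurableC.
  move=> x /= nAx; have [x1|x1] := leP x 1; last first.
    by right; rewrite /= ?in_itv /= x1.
  left => B0x; apply: nAx; left; split; last by rewrite /= S0K.
  by rewrite /Smap /= in_itv /=; lra.
have nu1 : fine (nu (Smap ord_max @^-1` (~` A))) <= fine (nu (~` B1)).
  have nuN : nu `]-oo, 0%R[%classic = 0%E.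
    apply: on_unit_interval_null => //.
    by apply/seteqP; split => x //=; rewrite !in_itv /= => -[]; lra.
  apply: le_fine_probability nuN _ => //.
  - by apply: measurable_Smap_preimage; exact: measurableC.
  - exact: measurableC.
  move=> x /= nAx; have [x0|x0] := leP 0 x; last first.
    by right; rewrite /= in_itv.
  left => B1x; apply: nAx; right; split; last by rewrite /= S1K.
  by rewrite /Smap /= in_itv /= andbT; lra.
have st_ge0 : 0 <= s * t by rewrite mulr_ge0.
have sqrt_split (g p : R) : Num.sqrt (s * g * (t * p)) =
    Num.sqrt (s * t) * Num.sqrt (g * p) by rewrite -sqrtrM// mulrACA.
have -> : Num.sqrt (s * t) * affinity p0 p1 k y =
    Num.sqrt (s * G ord0 y * (t * p0)) * k (H ord0 y) +
    Num.sqrt (s * G ord_max y * (t * p1)) * k (H ord_max y).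
  by rewrite !sqrt_split /affinity; ring.
apply: (le_trans _ (lerD le0 le1)).
have := ler_wpM2l (mulr_ge0 s0 (G_ge0 ord0 y01)) mu0.
have := ler_wpM2l (mulr_ge0 s0 (G_ge0 ord_max y01)) mu1.
have := ler_wpM2l (mulr_ge0 t0 p0_ge0) nu0.
have := ler_wpM2l (mulr_ge0 t0 p1_ge0) nu1.
by rewrite !mulrDr !mulrA; lra.
Qed.

(** Each induction step reads two digits, since only the second iterate of the affinity operator
    contracts uniformly; the constant [c ^+ n] factors out by linearity. *)
Lemma separated_by_pow n : separated_by (fun=> (2399 / 2400) ^+ n).
Proof.
elim: n => [|n IHn]; first exact: separated_by1.
apply: separated_by_le (separated_by_affinity (separated_by_affinity IHn)) => y y01.
have -> : affinity p0 p1 (affinity p0 p1 (fun=> (2399 / 2400) ^+ n)) y =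
    (2399 / 2400) ^+ n * affinity p0 p1 (affinity p0 p1 (fun=> 1)) y.
  by rewrite /affinity; ring.
rewrite exprSr; apply: ler_wpM2l (affinity2_le p0_ge0 p1_ge0 p01 y01).
by apply: exprn_ge0; lra.
Qed.

End Family.

Theorem proposition3p12 (R : realType)
    (mu : R -> probability (measurableTypeR R) R)
    (mu_family : is_GH_family mu)
    (y : R) (y01 : 0 <= y <= 1)
    (p0 p1 : R) (p0_ge0 : 0 <= p0) (p1_ge0 : 0 <= p1) (p01 : p0 + p1 = 1)
    (nu : probability (measurableTypeR R) R) (nu_ss : self_similar p0 p1 nu) :
  mutually_singular (mu y) nu.
Proof.
apply: mutually_singular_of_small => e e0.
have [|N _ Nle] := @near_expr_le R (2399 / 2400) e _ e0; first lra.
(* With [s = t = 1] the sum of the two errors is at most [c ^+ N <= e]; both are nonnegative, so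
   each is at most [e]. *)
have [A mA] := separated_by_pow mu_family p0_ge0 p1_ge0 p01 nu_ss N y01 ler01 ler01.
rewrite !mul1r sqrtr1 mul1r => Ale; exists A => //.
have muA := fine_probability_ge0 (mu y) A.
have nuA := fine_probability_ge0 nu (~` A).
by have := le_trans Ale (Nle N (leqnn N)); split; lra.
Qed.
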